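(* Let $X$ be a dendrite, let $G$ be a topological group acting continuously on $X$, and let $f\in E(X,G)$. Then for every $\varepsilon>0$ the set $X^1_{\varepsilon,f}$ is finite. In particular $\beta(f)\leq 2$ and $\beta(X,G)\leq 2$.
   Context: A dendrite is a compact, connected, locally connected, metrizable space $X$ such that any two points are the endpoints of a unique arc in $X$. Fix a compatible metric $d$ on $X$. Actions are assumed faithful. The Ellis semigroup $E(X,G)$ is the closure of $G$ (identified with $\{x\mapsto gx : g\in G\}$) in $X^X$ with the topology of pointwise convergence. (Every continuous action of a topological group on a dendrite is known to be tame, so the rank below is defined.) For $p\in E(X,G)$, $A\subseteq X$ and $x\in A$, let $\mathrm{osc}(p,x,A)=\inf\{\mathrm{diam}(p(V\cap A)) : V\text{ an open neighbourhood of }x\}$. For $\varepsilon>0$ let $A^1_{\varepsilon,p}=\{x\in A : \mathrm{osc}(p,x,A)\geq\varepsilon\}$. Iterate over countable ordinals: $A^0_{\varepsilon,p}=A$, $A^{\alpha+1}_{\varepsilon,p}=(A^\alpha_{\varepsilon,p})^1_{\varepsilon,p}$, and $A^\gamma_{\varepsilon,p}=\bigcap_{\alpha<\gamma}A^\alpha_{\varepsilon,p}$ for limit $\gamma$. Let $\beta(p,\varepsilon)$ be the least $\alpha<\omega_1$ with $X^\alpha_{\varepsilon,p}=\varnothing$ if it exists, and $\omega_1$ otherwise. Let $\beta(p)=\sup_{\varepsilon>0}\beta(p,\varepsilon)$ and $\beta(X,G)=\sup\{\beta(p) : p\in E(X,G)\}$. *)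

(* Defs.v *)
From HB Require Import structures.
From mathcomp Require Import all_boot all_order all_algebra.
From mathcomp Require Import all_classical all_reals all_analysis.
From mathcomp Require wochoice.

Set Implicit Arguments.
Unset Strict Implicit.
Unset Printing Implicit Defensive.

Import Order.TTheory GRing.Theory Num.Theory.
Import numFieldNormedType.Exports.

Local Open Scope classical_set_scope.

(** The set [omega1] of countable ordinals is realised as the set of those
    elements of a well-ordering of the continuum that have countably many
    predecessors.  It is well-founded ([omega1_min]), its proper initial
    segments are countable ([countable_omega1_lt]) and it is itself
    uncountable ([omega1_uncountable]); this determines the order type. *)

Definition code_le : rel (set nat) :=
  projT1 (wochoice.well_ordering_principle (set nat)).

Lemma code_le_min (A : set (set nat)) : A !=set0 ->
  exists2 z, A z & forall x, A x -> code_le z x.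
Proof.
move=> [x Ax].
have [|z [[zA zmin] _]] :=
    projT2 (wochoice.well_ordering_principle (set nat)) (fun y => `[< A y >]).
  by exists x; apply/asboolP.
exists z; first exact/asboolP.
by move=> y Ay; apply: zmin; apply/asboolP.
Qed.

Lemma code_le_refl : reflexive code_le.
Proof.
move=> x; have [z -> zmin] := @code_le_min [set x] (ex_intro _ x erefl).
exact: zmin.
Qed.

Lemma code_le_total : total code_le.
Proof.
move=> x y.
have [z [->|->] zmin] := @code_le_min [set x; y] (ex_intro _ x (or_introl erefl)).
  by rewrite zmin//; right.
by rewrite (zmin x) ?orbT//; left.
Qed.

Lemma code_le_anti : antisymmetric code_le.
Proof.
move=> x y /andP[xy yx].
have [|z [_ zuniq]] :=
    projT2 (wochoice.well_ordering_principle (set nat)) (pred2 x y).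
  by exists x; rewrite inE eqxx.
have <- : z = x.
  apply: zuniq; split; first by rewrite inE eqxx.
  by move=> t; rewrite inE => /orP[]/eqP-> //; exact: code_le_refl.
apply: zuniq; split; first by rewrite inE eqxx orbT.
by move=> t; rewrite inE => /orP[]/eqP-> //; exact: code_le_refl.
Qed.

Lemma code_le_trans : transitive code_le.
Proof.
move=> y x z xy yz.
have [t [[->|->]|->] tmin] :=
  @code_le_min [set x; y; z] (ex_intro _ x (or_introl (or_introl erefl))).
- by apply: tmin; right.
- have -> : x = y by apply: code_le_anti; rewrite xy tmin//; left; left.
  exact: yz.
- have <- : y = z; last exact: xy.
  by apply: code_le_anti; rewrite yz tmin//; left; right.
Qed.

Definition omega1 : Type :=
  {a : set nat | `[< countable [set b | code_le b a /\ b <> a] >]}.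

HB.instance Definition _ := gen_eqMixin omega1.
HB.instance Definition _ := gen_choiceMixin omega1.

Definition omega1_le (a b : omega1) : bool := code_le (sval a) (sval b).

Lemma omega1_le_refl : reflexive omega1_le.
Proof. by move=> a; exact: code_le_refl. Qed.

Lemma omega1_le_anti : antisymmetric omega1_le.
Proof. by move=> a b /code_le_anti; exact: val_inj. Qed.

Lemma omega1_le_trans : transitive omega1_le.
Proof. by move=> b a c; exact: code_le_trans. Qed.

Lemma omega1_le_total : total omega1_le.
Proof. by move=> a b; exact: code_le_total. Qed.

Fact omega1_display : Order.disp_t. Proof. exact: (Order.Disp tt tt). Qed.

HB.instance Definition _ := Order.Le_isPOrder.Build omega1_display omega1
  omega1_le_refl omega1_le_anti omega1_le_trans.
HB.instance Definition _ :=
  Order.POrder_isTotal.Build omega1_display omega1 omega1_le_total.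

Local Open Scope order_scope.

Lemma omega1_min (A : set omega1) : A !=set0 ->
  exists2 z, A z & forall x, A x -> z <= x.
Proof.
move=> [x Ax].
have [|_ [z Az <-] zmin] := @code_le_min [set sval y | y in A].
  by exists (sval x), x.
by exists z => // y Ay; apply: zmin; exists y.
Qed.

Lemma omega1_lt_wf : well_founded (fun a b : omega1 => a < b).
Proof.
move=> a; apply: contrapT => na.
have [z zA zmin] :=
  @omega1_min [set x | ~ Acc (fun a b : omega1 => a < b) x] (ex_intro _ a na).
apply: zA; constructor => y yz; apply: contrapT => /zmin.
by rewrite leNgt yz.
Qed.

Lemma countable_omega1_lt (a : omega1) : countable [set b | b < a].
Proof.
have -> : countable [set b | b < a] = countable (sval @` [set b | b < a]).
  apply/esym/eq_countable/inj_card_eq => b c _ _; exact: val_inj.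
case: a => a ca; have /asboolP := ca; apply: sub_countable.
apply: subset_card_le => _ [b /= ba <-]; split; first exact: (ltW ba).
by move=> eba; move: ba; rewrite lt_def => /andP[/eqP + _]; apply; exact: val_inj.
Qed.

Lemma omega1_uncountable : ~ countable [set: omega1].
Proof.
move=> c1.
pose S := [set a : set nat | countable [set b | code_le b a /\ b <> a]].
have cS : countable S.
  have : countable (@sval _ _ @` [set: omega1]).
    by apply: sub_countable c1; exact: card_image_le.
  apply: sub_countable; apply: subset_card_le => a Sa.
  by exists (exist _ a (asboolT Sa)).
have [ST|] := pselect (forall a, S a).
  have /countable_injP[f finj] : countable [set: set nat].
    by apply: sub_countable cS; exact: subset_card_le.
  pose D := [set n | exists2 A, n = f A & ~ A n].
  have [DD|DD] := pselect (D (f D)); last by apply: (DD); exists D.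
  have [A fDA] := DD; apply.
  by rewrite -(finj _ _ _ _ fDA) ?in_setT.
move=> /existsNP[a Sa].
have [z Sz zmin] := @code_le_min (~` S) (ex_intro _ a Sa).
apply: Sz; apply: sub_countable cS; apply: subset_card_le => b [bz nbz].
apply: contrapT => /zmin zb; apply: nbz.
by apply: code_le_anti; rewrite bz zb.
Qed.

Lemma omega1_nomax (a : omega1) : exists b, a < b.
Proof.
apply: contrapT => /forallNP amax; apply: omega1_uncountable.
have : countable ([set b | b < a] `|` [set a]).
  have /countable_injP[f finj] := countable_omega1_lt a.
  apply/countable_injP; exists (fun b => if b == a then 0%N else (f b).+1).
  move=> b c; rewrite !inE /= => bS cS.
  have [->|ba] := eqVneq b a; have [->|ca] := eqVneq c a => //.
  case=> /finj; apply; rewrite inE /=.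
    by case: bS => // ?; move: ba; rewrite (_ : b = a) ?eqxx.
  by case: cS => // ?; move: ca; rewrite (_ : c = a) ?eqxx.
apply: sub_countable; apply: subset_card_le => b _.
have [ba|ab|->] := ltgtP b a; [by left| |by right].
by have := amax b.
Qed.

Lemma omega1_zero_ex : exists z : omega1, forall a, z <= a.
Proof.
have [|z _ zmin] := @omega1_min setT; last by exists z => a; exact: zmin.
apply: contrapT => e; apply: omega1_uncountable.
rewrite (_ : setT = set0); first exact: countable0.
by apply/seteqP; split => // b _; apply: e; exists b.
Qed.

Lemma omega1_succ_ex (a : omega1) :
  exists2 b, a < b & forall c, a < c -> b <= c.
Proof. exact: (@omega1_min [set b | a < b] (omega1_nomax a)). Qed.

Definition ozero : omega1 := sval (cid omega1_zero_ex).

Definition osucc (a : omega1) : omega1 := sval (cid2 (omega1_succ_ex a)).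

Definition olimit (a : omega1) : Prop :=
  a <> ozero /\ forall b, a <> osucc b.

Lemma ozero_le (a : omega1) : ozero <= a.
Proof. by rewrite /ozero; case: cid => z /=; exact. Qed.

Lemma osucc_gt (a : omega1) : a < osucc a.
Proof. by rewrite /osucc; case: cid2. Qed.

Lemma osucc_le (a b : omega1) : a < b -> osucc a <= b.
Proof. by rewrite /osucc; case: cid2 => s /= _; exact. Qed.

Lemma osucc_inj : injective osucc.
Proof.
move=> a b ab; have [|/osucc_le|//] := ltgtP a b.
  by move=> /osucc_le; rewrite ab leNgt osucc_gt.
by rewrite -ab leNgt osucc_gt.
Qed.

(** The ordinals up to and including omega_1, the latter being [None]. *)

Definition ord : Type := option omega1.

HB.instance Definition _ := gen_eqMixin ord.
HB.instance Definition _ := gen_choiceMixin ord.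

Definition ord_le (a b : ord) : bool :=
  match a, b with
  | _, None => true
  | None, Some _ => false
  | Some a, Some b => a <= b
  end.

Lemma ord_le_refl : reflexive ord_le.
Proof. by case=> //= a; exact: lexx. Qed.

Lemma ord_le_anti : antisymmetric ord_le.
Proof. by move=> [a|] [b|] //= /le_anti ->. Qed.

Lemma ord_le_trans : transitive ord_le.
Proof. by move=> [b|] [a|] [c|] //=; exact: le_trans. Qed.

Lemma ord_le_total : total ord_le.
Proof. by move=> [a|] [b|] //=; exact: le_total. Qed.

Fact ord_display : Order.disp_t. Proof. exact: (Order.Disp tt tt). Qed.

HB.instance Definition _ := Order.Le_isPOrder.Build ord_display ord
  ord_le_refl ord_le_anti ord_le_trans.
HB.instance Definition _ :=
  Order.POrder_isTotal.Build ord_display ord ord_le_total.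

Definition ord_omega1 : ord := None.
Definition ord_countable (a : omega1) : ord := Some a.

Definition ord0 : ord := ord_countable ozero.
Definition ord2 : ord := ord_countable (osucc (osucc ozero)).

(** Every set of ordinals at most omega_1 has a supremum; that of the empty
    set is 0. *)

Lemma ord_supremums_neq0 (A : set ord) : supremums A !=set0.
Proof.
have [[a Aa]|nA] := pselect (exists a, ubound A (ord_countable a)).
  have [z Az zmin] := @omega1_min [set a | ubound A (ord_countable a)]
    (ex_intro _ a Aa).
  exists (ord_countable z); split => // -[b|] Ab //.
  exact: zmin.
exists ord_omega1; split; first by move=> [b|] _.
by move=> [b|] Ab //; exfalso; apply: nA; exists b.
Qed.

Definition ord_sup (A : set ord) : ord := supremum ord0 A.

(** Transfinite iteration of [D] along the countable ordinals, starting from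
    [A]: the three clauses are the zero, successor and limit steps. *)

Section iteration.
Context {X : Type} (D : set X -> set X) (A : set X).

Definition transfinite_step (a : omega1) (rec : forall b, b < a -> set X) :
    set X :=
  [set x | [/\ a = ozero -> A x,
    forall b (ba : b < a), a = osucc b -> D (rec b ba) x &
    olimit a -> forall b (ba : b < a), rec b ba x]].

Definition transfinite_iter : omega1 -> set X :=
  Fix omega1_lt_wf (fun=> set X) transfinite_step.

Lemma transfinite_iterE a :
  transfinite_iter a = transfinite_step (fun b (_ : b < a) => transfinite_iter b).
Proof.
rewrite /transfinite_iter Fix_eq// => b f g fg.
by congr transfinite_step; apply: functional_extensionality_dep => c;
  apply: functional_extensionality_dep => bc; exact: fg.
Qed.

Lemma transfinite_iter0 : transfinite_iter ozero = A.
Proof.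
rewrite transfinite_iterE; apply/seteqP; split => x; first by case=> /(_ erefl).
move=> Ax; split=> // [b b0|[]//].
by move: b0; rewrite ltNge ozero_le.
Qed.

Lemma transfinite_iterS a :
  transfinite_iter (osucc a) = D (transfinite_iter a).
Proof.
rewrite transfinite_iterE; apply/seteqP; split => x.
  by case=> _ /(_ a (osucc_gt a) erefl).
move=> Dx; split=> [a0||[_ /(_ a)]//].
- by have := osucc_gt a; rewrite a0 ltNge ozero_le.
- by move=> b ba /osucc_inj <-.
Qed.

Lemma transfinite_iter_limit a : olimit a ->
  transfinite_iter a = \bigcap_(b in [set b | b < a]) transfinite_iter b.
Proof.
move=> la; rewrite transfinite_iterE; apply/seteqP; split => x.
  by case=> _ _ /(_ la) h b /h.
move=> h; case: (la) => a0 aS; split=> [/a0|b _ /aS|_ b ba] //.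
exact: h.
Qed.

End iteration.

Local Close Scope order_scope.
Local Open Scope ring_scope.

Definition locally_connected (X : topologicalType) : Prop :=
  forall (x : X) (U : set X), nbhs x U ->
    exists V, [/\ open V, V x, V `<=` U & connected V].

(** [f] and [g] are mutually inverse homeomorphisms between [0, 1] and [A]. *)
Definition is_arc (R : realType) (X : topologicalType) (A : set X) (x y : X) :
    Prop :=
  exists (f : R -> X) (g : X -> R),
    [/\ {within `[0, 1], continuous f} /\ {within A, continuous g},
        f @` `[0, 1] = A, {in `[0, 1], cancel f g}, f 0 = x & f 1 = y].

(** Metrizability is part of the type [metricType R], whose topology is that
    of the distance [mdist]. *)
Definition is_dendrite (R : realType) (X : metricType R) : Prop :=
  [/\ compact [set: X], connected [set: X], locally_connected X &
      forall x y : X, x <> y -> exists! A : set X, is_arc R A x y].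

HB.mixin Record isTopologicalGroup G of Topological G & Group G := {
  mulg_continuous : continuous (fun gh : G * G => (gh.1 * gh.2)%g) ;
  invg_continuous : continuous (fun g : G => (g^-1)%g)
}.

#[short(type="topologicalGroupType")]
HB.structure Definition TopologicalGroup :=
  {G of isTopologicalGroup G & Topological G & Group G}.

Section actions.
Context (G : topologicalGroupType) (X : topologicalType) (act : G -> X -> X).

Definition continuous_action : Prop :=
  [/\ forall x, act 1%g x = x,
      forall g h x, act (g * h)%g x = act g (act h x) &
      continuous (fun gx : G * X => act gx.1 gx.2)].

Definition faithful_action : Prop :=
  forall g, (forall x, act g x = x) -> g = 1%g.

Definition ellis_semigroup : set (X -> X) :=
  closure (range act : set {ptws X -> X}).

End actions.

Section rank.
Context {R : realType} {X : metricType R}.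
Implicit Types (p : X -> X) (A : set X) (e : R).

Definition diam A : \bar R :=
  ereal_sup [set (mdist u.1 u.2)%:E | u in A `*` A].

Definition osc p (x : X) A : \bar R :=
  ereal_inf [set diam (p @` (V `&` A)) | V in [set V | open V /\ V x]].

Definition osc_derivative e p A : set X :=
  [set x | A x /\ (e%:E <= osc p x A)%E].

Definition osc_iter e p : omega1 -> set X :=
  transfinite_iter (osc_derivative e p) [set: X].

Definition beta_eps p e : ord :=
  xget ord_omega1 [set o | exists a, [/\ o = ord_countable a,
    osc_iter e p a = set0 &
    forall b, osc_iter e p b = set0 -> (a <= b)%O]].

Definition beta p : ord := ord_sup [set beta_eps p e | e in [set e | 0 < e]].

Definition beta_system (G : topologicalGroupType) (act : G -> X -> X) : ord :=
  ord_sup [set beta p | p in ellis_semigroup act].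

End rank.

(* Main.v *)
Require Import Defs.
From mathcomp Require Import all_boot all_order all_algebra finmap.
From mathcomp Require Import all_classical all_reals all_analysis.
From mathcomp Require Import zify ring lra.

(** Two disjoint connected open sets that both join two disjoint small
    connected open sets [B] and [B'] yield, since connected open subsets of a
    Peano continuum are arcwise connected, two different arcs with the same end
    points.  Hence, covering the dendrite by [k] small connected open sets,
    fewer than [k ^ 2 + 1] pairwise disjoint connected open sets have diameter
    at least [d].  If [f] oscillates by [e] at [n] points, pick disjoint
    connected neighbourhoods of these points and in each of them two points
    with distant images; a homeomorphism in [G] close to [f] at these [2 n]
    points maps the neighbourhoods to [n] disjoint connected open sets of
    diameter at least [e / 4], so [n] is bounded.

    The arcs come from nested simple chains of connected open sets.  A chain of
    minimal length among the sequences of small links that never step back in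
    the previous chain is simple, and if its mesh is small enough, at least two
    links lie in each link of the previous chain, so that the time spent in a
    link tends to zero. *)

Set Implicit Arguments.
Unset Strict Implicit.
Unset Printing Implicit Defensive.

Import Order.TTheory GRing.Theory Num.Theory.
Import numFieldNormedType.Exports.

Local Open Scope classical_set_scope.
Local Open Scope ring_scope.

(** * Connected sets in metric spaces *)

(** Locally on [A] the truth of [P] is constant, so the open sets [U], where [P] holds, and [W],
    where it fails, split [A]. This serves as induction along a connected set. *)
Lemma connected_local_ind (T : topologicalType) (A P : set T) : connected A ->
  A `&` P !=set0 ->
  (forall x, A x -> exists V, [/\ open V, V x &
    forall y z, A y -> A z -> V y -> V z -> P y -> P z]) ->
  A `<=` P.
Proof.
move=> cA AP0 loc.
pose U := \bigcup_(V in [set V | open V /\ A `&` V `<=` P]) V.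
pose W := \bigcup_(V in [set V | open V /\ A `&` V `<=` ~` P]) V.
have oU : open U by apply: bigcup_open => V [].
have oW : open W by apply: bigcup_open => V [].
have AUW x : A x -> if pselect (P x) then U x else W x.
  move=> Ax; have [V [oV Vx h]] := loc x Ax.
  case: pselect => Px; exists V => //; split=> // y [Ay Vy].
    exact: (h x).
  by move=> Py; apply: Px; apply: (h y).
suff <- : A `&` P = A by move=> x [].
apply: cA => //.
  exists U => //; apply/seteqP; split=> x [Ax].
    by move: (AUW x Ax); case: pselect.
  by move=> [V [_ VP] Vx]; split=> //; exact: VP.
exists (~` W); first exact: open_closedC.
apply/seteqP; split=> x [Ax].
  by move=> Px; split=> // -[V [_ VP] Vx]; exact: (VP x).
by move=> Wx; split=> //; move: (AUW x Ax); case: pselect.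
Qed.

Lemma finite_pos_bound (R : realDomainType) n (P : nat -> R -> Prop) :
  (forall i, (i < n)%N -> exists2 d, 0 < d & P i d) ->
  (forall i d d', P i d -> d' <= d -> P i d') ->
  exists2 d, 0 < d & forall i, (i < n)%N -> P i d.
Proof.
move=> + mono; elim: n => [|n IH] hP; first by exists 1.
have [i ni|d d0 dP] := IH; first exact/hP/ltnW.
have [e e0 eP] := hP n (ltnSn n).
exists (Num.min d e); first by rewrite lt_min d0.
move=> i; rewrite ltnS leq_eqVlt => /predU1P[->|lin].
  by apply: (mono _ _ _ eP); rewrite ge_min lexx orbT.
by apply: (mono _ _ _ (dP i lin)); rewrite ge_min lexx.
Qed.

Section metric.
Context {R : realType} {X : metricType R}.
Implicit Types (x y : X) (A B U V : set X) (d e : R).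

Definition small d A := forall x y, A x -> A y -> mdist x y < d.

Lemma nbhs_mdist_lt x d : 0 < d -> nbhs x [set y | mdist x y < d].
Proof. by move=> d0; apply/nbhs_ballP; exists d => //=; rewrite ballEmdist. Qed.

Lemma open_mdist_lt x U : open U -> U x ->
  exists2 d, 0 < d & forall y, mdist x y < d -> U y.
Proof.
move=> oU Ux; have /nbhs_ballP[d /= d0 dU] : nbhs x U by exact: open_nbhs_nbhs.
by exists d => // y xy; apply: dU; rewrite ballEmdist.
Qed.

Lemma mdist_disjoint A B : compact A -> closed B -> A `&` B = set0 ->
  exists2 d, 0 < d & forall x y, A x -> B y -> d <= mdist x y.
Proof.
move=> /compact_near_coveringP cA cB AB0.
have : \forall d \near 0^'+, A `<=` [set x | forall y, B y -> d <= mdist x y].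
  apply: cA => x Ax; have [||e e0 eB] := @open_mdist_lt x (~` B).
  - exact: closed_openC.
  - by move=> Bx; have : (A `&` B) x by []; rewrite AB0.
  exists ([set y | mdist x y < e / 2], [set d | d < e / 2]) => /=.
    split; first by apply: nbhs_mdist_lt; rewrite divr_gt0.
    by apply: nbhs_right_lt; rewrite divr_gt0.
  move=> [z d] /= [xz de] y By; rewrite leNgt; apply/negP => zy.
  apply: (eB y) By; have := metric_triangle x z y.
  move: xz de zy; lra.
move=> [d /= d0 h]; exists (d / 2); first by rewrite divr_gt0.
move=> x y Ax By; apply: (h (d / 2)) => //=; last by rewrite divr_gt0.
by rewrite sub0r normrN gtr0_norm ?divr_gt0// ltr_pdivrMr// ltr_pMr// ltr1n.
Qed.

Hypothesis locX : locally_connected X.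

Lemma small_connected_nbhs x U d : open U -> U x -> 0 < d ->
  exists V, [/\ open V, V x, connected V, closure V `<=` U & small d V].
Proof.
move=> oU Ux d0; have [e e0 eU] := open_mdist_lt oU Ux.
pose r := Num.min (d / 2) (e / 2).
have r0 : 0 < r by rewrite lt_min !divr_gt0.
have [V [oV Vx Vr cV]] := locX (nbhs_mdist_lt x r0).
have rd : r <= d / 2 by rewrite ge_min lexx.
have re : r <= e / 2 by rewrite ge_min lexx orbT.
exists V; split=> //.
  move=> z /(_ _ (nbhs_mdist_lt z r0))[y [/Vr /= xy /= zy]]; apply: eU.
  have := metric_triangle x y z; rewrite (metric_sym y z); move: re xy zy; lra.
move=> y z /Vr /= xy /Vr /= xz.
have := metric_triangle y x z; rewrite (metric_sym y x); move: rd xy xz; lra.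
Qed.

(** Local induction along [U]: a set reaching a point is enlarged by a small connected neighbourhood
    with closure in [U]. It turns disjoint links into links with disjoint closures and keeps their
    junction points. *)
Lemma connected_shrink U x y : open U -> connected U -> U x -> U y ->
  exists V, [/\ open V, connected V, closure V `<=` U, V x & V y].
Proof.
move=> oU cU Ux Uy.
pose P := [set y | exists V, [/\ open V, connected V, closure V `<=` U, V x & V y]].
suff : U `<=` P by apply.
apply: connected_local_ind => //.
  exists x; split=> //.
  by have [V [*]] := small_connected_nbhs oU Ux (@ltr01 R); exists V.
move=> z Uz; have [V [oV Vz cV VU _]] := small_connected_nbhs oU Uz (@ltr01 R).
exists V; split=> // u v Uu Uv Vu Vv [W [oW cW WU Wx Wu]].
exists (W `|` V); split;
  [exact: openU| |by rewrite closureU subUset|by left|by right].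
by apply: connectedU => //; exists u.
Qed.

End metric.

(** * Refining simple chains *)

Section chains.
Context {R : realType} {X : metricType R}.
Implicit Types (x y : X) (A B U V : set X) (d e : R).
Hypothesis cX : compact [set: X].
Hypothesis locX : locally_connected X.
Variables p q : X.

(** The end links are points, which fixes the ends of the limit path. Closures are asked to be
    disjoint because the limit path is located by closures of links. *)
Definition simple_chain M (c : nat -> set X) :=
  [/\ (1 < M)%N, c 0%N = [set p] /\ c M = [set q],
    forall i, (0 < i < M)%N -> open (c i) /\ connected (c i),
    forall i, (i < M)%N -> c i `&` c i.+1 !=set0 &
    forall i j, (i.+1 < j <= M)%N -> closure (c i) `&` closure (c j) = set0].

Section refinement.
Variables (M : nat) (c : nat -> set X) (d : R).
Hypothesis cM : simple_chain M c.
Hypothesis d0 : 0 < d.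

Definition good_link (V : set X) i :=
  [/\ (0 < i < M)%N, open V, connected V, V `<=` c i & small d V].

(* A sequence of links that never steps back in the coarse chain [c]; it may
   cross itself. *)
Definition walk L (W : nat -> set X) (r : nat -> nat) :=
  [/\ W 0%N = [set p], r 0%N = 0%N,
    forall j, (0 < j <= L)%N -> good_link (W j) (r j) &
    forall j, (j < L)%N -> W j `&` W j.+1 !=set0 /\ (r j <= r j.+1)%N].

Definition reached V i := exists L W r, [/\ walk L W r, W L = V & r L = i].

Lemma reached_step V i V' i' : reached V i -> good_link V' i' -> (i <= i')%N ->
  V `&` V' !=set0 -> reached V' i'.
Proof.
move=> [L [W [r [[W0 r0 gW lW] WL rL]]]] gV' ii' VV'.
exists L.+1, (fun j => if (j <= L)%N then W j else V'),
  (fun j => if (j <= L)%N then r j else i'); rewrite ltnn; split=> //.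
split=> //= j jL.
  by case: ifP => // jL'; apply: gW; lia.
have -> : (j <= L)%N by lia.
case: ifP => [jL'|jL']; first exact: lW.
have -> : j = L by lia.
by rewrite WL rL.
Qed.

Let good_nbhs i x : (0 < i < M)%N -> c i x ->
  exists V, [/\ open V, V x & good_link V i].
Proof.
move=> iM cx; have [_ _ oc _ _] := cM; have [oi ci] := oc i iM.
have [V [oV Vx cV Vc sV]] := small_connected_nbhs locX oi cx d0.
by exists V; split=> //; split=> //; apply: subset_trans Vc; exact: subset_closure.
Qed.

(** Induction on the link, and local induction inside it: small links enter it at a point shared
    with the previous link and then spread over it. *)
Lemma reached_all i : (0 < i < M)%N ->
  c i `<=` [set x | exists2 V, V x & reached V i].
Proof.
elim: i => // i IH iM; have [M1 [c0 _] oc lc _] := cM.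
have [oi ci] := oc _ iM; apply: connected_local_ind => //.
  have [x [cx cx']] : c i `&` c i.+1 !=set0 by apply: lc; lia.
  have [V [oV Vx gV]] := good_nbhs iM cx'.
  exists x; split=> //; exists V => //.
  have [i0|i0] := posnP i.
    have r0 : reached [set p] 0%N.
      by exists 0%N, (fun=> [set p]), (fun=> 0%N); split=> //; split=> // j; lia.
    apply: (reached_step r0 gV) => //.
    by exists x; split=> //; move: cx; rewrite i0 c0.
  have [|W Wx rW] := IH _ _ cx; first lia.
  by apply: (reached_step rW gV) => //; exists x.
move=> x cx; have [V [oV Vx gV]] := good_nbhs iM cx.
exists V; split=> // y z _ _ Vy Vz [W Wy rW]; exists V => //.
by apply: (reached_step rW gV) => //; exists y.
Qed.

Definition full_walk L (W : nat -> set X) (r : nat -> nat) :=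
  [/\ W 0%N = [set p] /\ W L = [set q], r 0%N = 0%N /\ r L = M,
    forall j, (0 < j < L)%N -> good_link (W j) (r j) &
    forall j, (j < L)%N -> W j `&` W j.+1 !=set0 /\ (r j <= r j.+1)%N].

Lemma full_walk_ex : exists L W r, full_walk L W r.
Proof.
have [M1 [_ cq] _ lc _] := cM.
have [x [cx]] : c M.-1 `&` c M.-1.+1 !=set0 by apply: lc; lia.
rewrite prednK ?cq; last lia.
move=> /= xq; have [|V Vx [L [W [r [[W0 r0 gW lW] WL rL]]]]] := reached_all _ cx.
  lia.
exists L.+1, (fun j => if (j <= L)%N then W j else [set q]),
  (fun j => if (j <= L)%N then r j else M); split=> /=; rewrite ?ltnn//.
  move=> j jL; have -> : (j <= L)%N by lia.
  by apply: gW; lia.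
move=> j jL; have -> : (j <= L)%N by lia.
case: ifP => [jL'|jL']; first exact: lW.
have -> : j = L by lia.
by rewrite WL rL; split; [exists x|lia].
Qed.

(** Deleting the links strictly between [i] and [j] leaves a walk, since [W i] meets [W j] and [r]
    is nondecreasing. *)
Lemma full_walk_shortcut L W r i j : full_walk L W r -> (i.+1 < j <= L)%N ->
  W i `&` W j !=set0 -> exists L' W' r', (L' < L)%N /\ full_walk L' W' r'.
Proof.
move=> [[W0 WL] [r0 rL] gW lW] ijL Wij.
have mono a b : (a <= b <= L)%N -> (r a <= r b)%N.
  elim: b => [|b IH] ab; first by have -> : a = 0%N by lia.
  have [->//|ab'] := eqVneq a b.+1.
  by apply: leq_trans (IH _) _; [lia|apply: (lW b _).2; lia].
pose s k := if (k <= i)%N then k else (k + (j - i.+1))%N.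
exists (L - (j - i.+1))%N, (W \o s), (r \o s); split; first lia.
have sL : s (L - (j - i.+1))%N = L by rewrite /s; case: ifP; lia.
split; rewrite /= ?sL// => k kL.
  by apply: gW; rewrite /s; case: ifP; lia.
rewrite /s; case: ltngtP => ki.
- by apply: lW; lia.
- by rewrite addSn; apply: lW; lia.
- rewrite ki; have -> : (i.+1 + (j - i.+1) = j)%N by lia.
  by split=> //; apply: mono; lia.
Qed.

Lemma full_walk_simple : exists L W r, full_walk L W r /\
  forall i j, (i.+1 < j <= L)%N -> W i `&` W j = set0.
Proof.
have exL : exists L, `[< exists W r, full_walk L W r >].
  by have [L [W [r h]]] := full_walk_ex; exists L; apply/asboolP; exists W, r.
case: (ex_minnP exL) => L /asboolP[W [r h]] minL; exists L, W, r; split=> //.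
move=> i j ijL; have [//|/set0P Wij] := eqVneq (W i `&` W j) set0.
have [L' [W' [r' [L'L h']]]] := full_walk_shortcut h ijL Wij.
have /minL : `[< exists W r, full_walk L' W r >] by apply/asboolP; exists W', r'.
lia.
Qed.

End refinement.

(** The last clause, two consecutive fine links in each interior coarse link, is what allows
    durations to be halved. *)
Definition refines M (c : nat -> set X) M' c' (r : nat -> nat) e :=
  [/\ r 0%N = 0%N /\ r M' = M,
    forall j, (j < M')%N -> (r j <= r j.+1 <= (r j).+1)%N,
    forall j, (0 < j < M')%N -> (0 < r j < M)%N /\ small e (c' j),
    forall j, (j <= M')%N -> closure (c' j) `<=` c (r j) &
    forall i, (0 < i < M)%N -> exists j, [/\ (j.+1 < M')%N, r j = i & r j.+1 = i]].

(** Closures of links two apart are disjoint compact sets, hence at positive distance, and there are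
    finitely many such pairs. *)
Lemma chain_gap M (c : nat -> set X) : simple_chain M c ->
  exists2 d, 0 < d & forall i, (0 < i < M)%N ->
    forall x y, c i.-1 x -> c i.+1 y -> d <= mdist x y.
Proof.
move=> [M1 _ _ _ disj].
have [|i d d' h dd i0 x y cx cy|d d0 h] := @finite_pos_bound R M
  (fun i d => (0 < i)%N ->
    forall x y, c i.-1 x -> c i.+1 y -> d <= mdist x y).
- move=> [|i] iM; first by exists 1.
  have ccl : compact (closure (c i)).
    by apply: subclosed_compact cX _ => //; exact: closed_closure.
  have [d d0 h] : exists2 d, 0 < d &
      forall x y, closure (c i) x -> closure (c i.+2) y -> d <= mdist x y.
    by apply: mdist_disjoint => //; [exact: closed_closure|apply: disj; lia].
  by exists d => // _ x y cx cy; apply: h; exact: subset_closure.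
- by apply: le_trans dd _; exact: h.
- by exists d => // i /andP[i0 iM]; exact: h.
Qed.

Lemma chain_refine M c e : simple_chain M c -> 0 < e ->
  exists M' c' r, simple_chain M' c' /\ refines M c M' c' r e.
Proof.
move=> cM e0; have [d0 d00 gap] := chain_gap cM.
(* [e] bounds the mesh; the gap [d0] keeps a single fine link from crossing a coarse one. *)
pose d := Num.min d0 e.
have d_gt0 : 0 < d by rewrite lt_min d00.
have [L [W [r [[[W0 WL] [r0 rL] gW lW] simple]]]] := full_walk_simple cM d_gt0.
have [M1 [c0 cq] oc _ disj] := cM.
have cl1 (x : X) : closure [set x] = [set x].
  apply/esym/closure_id/accessible_closed_set1/hausdorff_accessible.
  exact: metric_hausdorff.
have Wc j : (j <= L)%N -> W j `<=` c (r j).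
  move=> jL; have [->|j0] := posnP j; first by rewrite W0 r0 c0.
  have [->|jL'] := eqVneq j L; first by rewrite WL rL cq.
  by have [|_ _ _ + _] := gW j; [lia|].
(* A larger jump would put a common point of [W j] and [W j.+1] into two nonadjacent coarse
   links. *)
have step j : (j < L)%N -> (r j <= r j.+1 <= (r j).+1)%N.
  move=> jL; have [[x [Wx Wx']] rr] := lW j jL.
  rewrite rr /= leqNgt; apply/negP => rr'.
  have rM : (r j.+1 <= M)%N.
    have [->|jL'] := eqVneq j.+1 L; first by rewrite rL.
    by have [|+ _ _ _ _] := gW j.+1; lia.
  have : (closure (c (r j)) `&` closure (c (r j.+1))) x.
    by split; apply: subset_closure; [apply: (Wc j)|apply: (Wc j.+1)] => //; lia.
  by rewrite disj//; lia.
have L1 : (1 < L)%N.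
  rewrite ltnNge; apply/negP => L1.
  have [L0|L0] := posnP L; first by move: rL; rewrite L0 r0; lia.
  have := step 0%N L0; have -> : 1%N = L by lia.
  by rewrite r0 rL; lia.
(* The [z j] are junction points, kept when [W j] is shrunk to [V j]. *)
have /choice[z zP] j : exists x, (j < L)%N -> W j x /\ W j.+1 x.
  have [jL|] := boolP (j < L)%N; last by exists p.
  by have [[x Wx] _] := lW j jL; exists x.
have /choice[V VP] j : exists V, (0 < j < L)%N ->
    [/\ open V, connected V, closure V `<=` W j, V (z j.-1) & V (z j)].
  have [jL|] := boolP (0 < j < L)%N; last by exists set0.
  have [_ oW cW _ _] := gW j jL.
  have [V VP] : exists V,
      [/\ open V, connected V, closure V `<=` W j, V (z j.-1) & V (z j)].
    apply: connected_shrink => //; last by apply: (zP j _).1; lia.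
    by have [|_] := zP j.-1; [lia|rewrite prednK//; lia].
  by exists V.
pose c' j := if (0 < j < L)%N then V j else W j.
have cW' j : (j <= L)%N -> closure (c' j) `<=` W j.
  move=> jL; rewrite /c'; case: ifPn => jL'; first by have [] := VP j jL'.
  have [->|j0] := posnP j; first by rewrite W0 cl1.
  have -> : j = L by lia.
  by rewrite WL cl1.
have c'z j : (j < L)%N -> c' j (z j) /\ c' j.+1 (z j).
  move=> jL; have [Wz Wz'] := zP j jL; rewrite /c'; split; case: ifPn => // jL'.
    by have [] := VP j jL'.
  by have [] := VP j.+1 jL'.
exists L, c', r; split; split=> //.
- by rewrite /c' /= ltnn andbF.
- by move=> j jL; rewrite /c' jL; have [] := VP j jL.
- by move=> j jL; exists (z j); exact: c'z.
- move=> i j ijL; apply/seteqP; split=> // x [/cW' Wi /cW' Wj].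
  by rewrite -(simple i j ijL); split; [apply: Wi; lia|apply: Wj; lia].
- move=> j jL; have [rj _ _ _ sW] := gW j jL; split=> //.
  move=> x y /subset_closure/cW' Wx /subset_closure/cW' Wy.
  have : d <= e by rewrite ge_min lexx orbT.
  by apply: lt_le_trans; apply: sW; [apply: Wx; lia|apply: Wy; lia].
- by move=> j jL; apply: subset_trans (Wc j jL); exact: cW'.
move=> i iM.
have exj : exists j, (i <= r j)%N by exists L; lia.
(* For the first [j] with [i <= r j], steps of at most one give [r j = i] and [r j.-1 = i.-1]. *)
case: (ex_minnP exj) => j ij minj.
have j0 : (0 < j)%N by case: (posnP j) => // j0; move: ij; rewrite j0 r0; lia.
have jL : (j <= L)%N by apply: minj; lia.
have rj1 : (r j.-1 < i)%N by rewrite ltnNge; apply/negP => /minj; lia.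
have := step j.-1; rewrite prednK// => /(_ jL) stepj.
have rji : r j = i by lia.
have jL' : (j < L)%N.
  by rewrite ltn_neqAle jL andbT; apply/eqP => jL'; move: rL; rewrite -jL'; lia.
have stepj' := step j jL'.
have [rj'|rj'] := eqVneq (r j.+1) i.
  exists j; split=> //; rewrite ltn_neqAle jL' andbT.
  by apply/eqP => jL''; move: rL; rewrite -jL''; lia.
have zj1 := zP j.-1; have zj := zP j jL'.
rewrite prednK// in zj1; have {}zj1 := zj1 jL.
have jj : (0 < j < L)%N by lia.
(* If the next link left [c i], then [W j] alone would join [c i.-1] to [c i.+1], against the gap
   [d0]. *)
have zz : mdist (z j.-1) (z j) < d.
  by have [_ _ _ _ sW] := gW j jj; apply: sW; [exact: zj1.2|exact: zj.1].
have : d0 <= mdist (z j.-1) (z j).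
  apply: (gap i iM).
    have <- : r j.-1 = i.-1 by lia.
    by apply: Wc; [lia|exact: zj1.1].
  have <- : r j.+1 = i.+1 by lia.
  by apply: Wc; [lia|exact: zj.2].
by rewrite leNgt (lt_le_trans zz)// ge_min lexx.
Qed.

End chains.

(** * Timetables *)

(* The link [i] of a chain is traversed during [[T i, T i.+1[]; the two end
   points [p] and [q] occupy [[-1, 0[] and [[1, 2[]. *)
Definition timetable (R : realType) M (T : nat -> R) :=
  [/\ T 0%N = -1, T 1%N = 0, T M = 1, T M.+1 = 2 &
    forall i, (i <= M)%N -> T i < T i.+1].

(** As [r] is nondecreasing, the fine links in a coarse link form a block, which shares its time
    equally. Interior blocks have at least two members, hence the factor one half. *)
Lemma timetable_refine (R : realType) M (T : nat -> R) M' (r : nat -> nat) :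
  timetable M T -> (1 < M')%N ->
  r 0%N = 0%N -> r M' = M ->
  (forall j, (j < M')%N -> (r j <= r j.+1 <= (r j).+1)%N) ->
  (forall j, (0 < j < M')%N -> (0 < r j < M)%N) ->
  (forall i, (0 < i < M)%N -> exists j, [/\ (j.+1 < M')%N, r j = i & r j.+1 = i]) ->
  exists T', [/\ timetable M' T',
    forall j, (j <= M')%N -> T (r j) <= T' j /\ T' j.+1 <= T (r j).+1 &
    forall j, (0 < j < M')%N -> T' j.+1 - T' j <= (T (r j).+1 - T (r j)) / 2].
Proof.
move=> [T0 T1 TM TM1 Tinc] M'1 r0 rM step inner two.
have rmono a b : (a <= b <= M')%N -> (r a <= r b)%N.
  elim: b => [|b IH] ab; first by have -> : a = 0%N by lia.
  have [->//|ab'] := eqVneq a b.+1.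
  by apply: leq_trans (IH _) _; [lia|have := step b; lia].
(* [N i] is the number of fine links inside the coarse link [i], and [b j] the
   number of those inside [r j] that precede [j]. *)
pose N i := count (fun k => r k == i) (iota 0 M'.+1).
pose b j := count (fun k => r k == r j) (iota 0 j).
pose s j := (b j)%:R / (N (r j))%:R : R.
(* The value 2 is needed at [M'.+1], where the last link ends. *)
pose T' j := if (j <= M')%N then T (r j) + (T (r j).+1 - T (r j)) * s j else 2.
have Nsplit j : (j <= M')%N ->
    N (r j) = ((b j).+1 + count (fun k => r k == r j) (iota j.+1 (M' - j)))%N.
  move=> jM; rewrite /N /b; have -> : M'.+1 = (j + (1 + (M' - j)))%N by lia.
  by rewrite !iotaD !count_cat /= add0n eqxx addn1; lia.
have N0 j : (j <= M')%N -> (0 : R) < (N (r j))%:R.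
  by move=> jM; rewrite ltr0n Nsplit.
have s0 j : 0 <= s j by rewrite divr_ge0.
have bS_same j : r j.+1 = r j -> b j.+1 = (b j).+1.
  by move=> rr; rewrite /b rr -[j.+1]addn1 iotaD count_cat /= add0n eqxx addn1; lia.
have bS_next j : (j < M')%N -> r j.+1 = (r j).+1 -> b j.+1 = 0%N.
  move=> jM rr; apply/eqP; rewrite eqn0Ngt -has_count -all_predC; apply/allP => k.
  rewrite mem_iota add0n => kj; rewrite /= rr neq_ltn ltnS.
  by rewrite rmono//; lia.
have N_next j : (j < M')%N -> r j.+1 = (r j).+1 -> N (r j) = (b j).+1.
  move=> jM rr; rewrite Nsplit; last lia.
  apply/eqP; rewrite -[eqbRHS]addn0 eqn_add2l eqn0Ngt -has_count -all_predC.
  apply/allP => k; rewrite mem_iota => kj; rewrite /= neq_ltn; apply/orP; right.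
  by apply: (@leq_trans (r j.+1)); [lia|apply: rmono; lia].
have T'S j : (j < M')%N ->
    T' j.+1 - T' j = (T (r j).+1 - T (r j)) / (N (r j))%:R.
  move=> jM; have jM' : (j <= M')%N by lia.
  have Nn0 : (N (r j))%:R != 0 :> R by rewrite gt_eqF// N0.
  rewrite /T' jM jM' /s.
  have [rr|rr] : r j.+1 = r j \/ r j.+1 = (r j).+1 by have := step j jM; lia.
    by rewrite bS_same// rr -[in (b j).+1]addn1 natrD; field.
  rewrite bS_next// rr mul0r mulr0 addr0 N_next// -[in (b j).+1]addn1 natrD.
  by field; rewrite natr1 pnatr_eq0.
have rjM j : (j <= M')%N -> (r j <= M)%N by move=> jM; rewrite -rM rmono// jM /=.
have T'le j : (j <= M')%N -> T (r j) <= T' j.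
  move=> jM; rewrite /T' jM lerDl mulr_ge0// subr_ge0.
  exact/ltW/Tinc/rjM.
(* Coarse links 0 and [M] each contain just one fine link, so the times 0 and 1 are kept. *)
have r1 : r 1%N = 1%N by have := step 0%N; have := inner 1%N; lia.
have rM1 : r M'.-1 = M.-1.
  by have := step M'.-1; have := inner M'.-1; rewrite prednK; lia.
have M'E : M'.-1.+1 = M' by lia.
have M1 : (0 < M)%N by have := inner 1%N; lia.
have bM : b M' = 0%N by have := bS_next M'.-1; rewrite M'E rM1 rM; apply; lia.
have T'S1 j : (j <= M')%N -> T' j.+1 <= T (r j).+1.
  rewrite leq_eqVlt => /predU1P[->|jM].
    by rewrite /T' ltnn rM TM1.
  have jM' : (j <= M')%N by lia.
  have -> : T' j.+1 =
      T (r j) + (T (r j).+1 - T (r j)) * ((b j).+1%:R / (N (r j))%:R).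
    rewrite -(subrK (T' j) (T' j.+1)) T'S// /T' jM' /s -[in (b j).+1]addn1 natrD.
    by field; rewrite gt_eqF// N0.
  rewrite -lerBrDl ler_piMr//.
    by rewrite subr_ge0; apply/ltW/Tinc/rjM.
  by rewrite ler_pdivrMr ?N0// mul1r ler_nat Nsplit// leq_addr.
exists T'; split.
- split.
  + by rewrite /T' /= r0 T0 T1 /s /b /= mul0r mulr0 addr0.
  + rewrite /T' ltnW// r1 T1 /s bS_next ?r0 ?r1//; last lia.
    by rewrite mul0r mulr0 addr0.
  + by rewrite /T' leqnn rM TM /s bM mul0r mulr0 addr0.
  + by rewrite /T' ltnn.
  + move=> j; rewrite leq_eqVlt => /predU1P[->|jM].
      by rewrite /T' leqnn ltnn rM TM /s bM mul0r mulr0 addr0 ltr1n.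
    rewrite -subr_gt0 T'S// divr_gt0 ?N0// ?subr_gt0; last lia.
    by apply: Tinc; apply: rjM; lia.
- by move=> j jM; split; [exact: T'le|exact: T'S1].
move=> j jM; rewrite T'S; last lia.
have N2 : (2 <= N (r j))%N.
  have [k [kM rk rk1]] := two _ (inner j jM).
  rewrite -rk Nsplit; last lia.
  have -> : (M' - k = 1 + (M' - k.+1))%N by lia.
  by rewrite iotaD count_cat /= rk1 rk eqxx; lia.
apply: ler_wpM2l; first by rewrite subr_ge0; apply/ltW/Tinc/rjM; lia.
by rewrite lef_pV2 ?posrE ?N0 ?(ler_nat R 2)//; lia.
Qed.

(** * Arcs in connected open sets *)

Lemma indexed_dependent_choice (S : Type) (P : S -> Prop)
    (Q : nat -> S -> S -> Prop) s0 :
  P s0 -> (forall n s, P s -> exists s', P s' /\ Q n s s') ->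
  exists u : nat -> S, u 0%N = s0 /\ forall n, P (u n) /\ Q n (u n) (u n.+1).
Proof.
move=> Ps0 step.
have /choice[f fP] (ns : nat * S) : exists s', P ns.2 -> P s' /\ Q ns.1 ns.2 s'.
  have [/step-/(_ ns.1)[s' h]|nP] := pselect (P ns.2); first by exists s'.
  by exists s0.
pose u := nat_rect (fun=> S) s0 (fun n s => f (n, s)).
have Pu n : P (u n) by elim: n => // n /(fP (n, _))[].
by exists u; split=> // n; split=> //; have [] := fP (n, u n) (Pu n).
Qed.

Lemma nested_closed_nonempty (T : topologicalType) (D : nat -> set T) :
  compact [set: T] -> (forall n, closed (D n)) -> (forall n, D n !=set0) ->
  (forall n, D n.+1 `<=` D n) -> exists x, forall n, D n x.
Proof.
move=> cT cD /choice[x xD] DS.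
have Dle n k : D (n + k)%N `<=` D n.
  by elim: k => [|k IH]; rewrite ?addn0// addnS; apply: subset_trans IH.
have [|y [_ cly]] := cT (x @ \oo) _; first exact: filterT.
exists y => n; apply: cD => V yV; apply: cly => //.
by exists n => // k /= nk; have := xD k; rewrite -(subnKC nk); exact: Dle.
Qed.

(** The preimage under [g] of a closed set is the image under [f] of a compact part of [K], hence
    closed. *)
Lemma compact_cancel_continuous (S T : topologicalType) (K : set S)
    (f : S -> T) (g : T -> S) : hausdorff_space T -> compact K -> closed K ->
  {within K, continuous f} -> {in K, cancel f g} ->
  {within f @` K, continuous g}.
Proof.
move=> hT cK clK cf fg; apply/continuous_closedP => C cC; apply/closed_subspaceP.
exists (f @` (K `&` C)).
  apply: compact_closed => //; apply: continuous_compact.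
    by apply: continuous_subspaceW cf => x [].
  exact: compact_closedI.
apply/seteqP; split=> y.
  move=> [[x [Kx Cx] <-] _]; split; last by exists x.
  by change (C (g (f x))); rewrite fg ?inE.
move=> [Cy [x Kx xy]]; have {Cy} : C (g y) := Cy.
by rewrite -xy fg ?inE// => Cx; split; exists x.
Qed.

Lemma half_expr_lt (R : realType) (e : R) : 0 < e -> exists n, 2^-1 ^+ n < e.
Proof.
move=> e0; have h1 : `|2^-1 : R| < 1.
  by rewrite gtr0_norm ?invr_gt0// invf_lt1// ltr1n.
have /cvgr0Pnorm_lt/(_ e e0)[n _ /(_ n (leqnn n))] := cvg_expr h1.
by rewrite /= ger0_norm ?exprn_ge0 ?invr_ge0//; exists n.
Qed.

Section timetable_theory.
Context {R : realType} {M : nat} {T : nat -> R}.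
Hypothesis TM : timetable M T.

Definition cell (t : R) i := (i <= M)%N /\ T i <= t < T i.+1.

Lemma timetable_lt i j : (i < j <= M.+1)%N -> T i < T j.
Proof.
have [_ _ _ _ inc] := TM; elim: j => [|j IH] ij; first lia.
have [->|ij'] := eqVneq i j; first by apply: inc; lia.
by apply: lt_trans (IH _) (inc j _); lia.
Qed.

Lemma timetable_le i j : (i <= j <= M.+1)%N -> T i <= T j.
Proof.
move=> ij; have [->//|ij'] := eqVneq i j.
by apply/ltW/timetable_lt; lia.
Qed.

Lemma cell_ex t : -1 <= t < 2 -> exists i, cell t i.
Proof.
have [T0 _ _ TM1 _] := TM; rewrite -T0 -TM1 => /andP[t0 tM].
have exi : exists i, t < T i by exists M.+1.
case: (ex_minnP exi) => -[|i] ti mini; first by move: ti; rewrite ltNge t0.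
exists i; split; first by have := mini _ tM.
by rewrite ti andbT leNgt; apply/negP => /mini; rewrite ltnn.
Qed.

Lemma cell_le s t i j : cell s i -> cell t j -> s <= t -> (i <= j)%N.
Proof.
move=> [iM /andP[si _]] [jM /andP[_ tj]] st; rewrite leqNgt; apply/negP => ji.
have : T j.+1 <= T i by apply: timetable_le; lia.
by move: si tj st; lra.
Qed.

Lemma cell_unique t i j : cell t i -> cell t j -> i = j.
Proof.
by move=> ci cj; apply/eqP; rewrite eqn_leq (cell_le ci cj)// (cell_le cj ci).
Qed.

Lemma cell_gt0 t i : cell t i -> 0 <= t -> (0 < i)%N.
Proof.
have [_ T1 _ _ _] := TM.
by case: i => // -[_]; rewrite T1 => /andP[_] /lt_le_trans h /h; rewrite ltxx.
Qed.

End timetable_theory.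

Section arcs.
Context {R : realType} {X : metricType R}.
Hypothesis cX : compact [set: X].
Hypothesis locX : locally_connected X.
Variables (p q : X) (U : set X).
Hypotheses (oU : open U) (cU : connected U) (Up : U p) (Uq : U q).
Hypothesis pq : p <> q.

Let closure1 (x : X) : closure [set x] = [set x].
Proof.
apply/esym/closure_id/accessible_closed_set1/hausdorff_accessible.
exact: metric_hausdorff.
Qed.

Record stage := Stage { last_link : nat; link :> nat -> set X; time : nat -> R }.

Definition valid s :=
  simple_chain p q (last_link s) (link s) /\ timetable (last_link s) (time s).

(** Links and time spans are both nested, so the link occupied at a given time lies in the one
    occupied at the previous stage; [n] sets the mesh. *)
Definition finer n s s' := exists r : nat -> nat,
  (forall j, (j <= last_link s')%N -> [/\ (r j <= last_link s)%N,
    closure (link s' j) `<=` link s (r j),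
    time s (r j) <= time s' j & time s' j.+1 <= time s (r j).+1]) /\
  (forall j, (0 < j < last_link s')%N -> [/\ small (2^-1 ^+ n) (link s' j),
    (0 < r j < last_link s)%N &
    time s' j.+1 - time s' j <= (time s (r j).+1 - time s (r j)) / 2]).

(** With [U] as the sole interior link, all later interior links are confined to [U]. *)
Definition stage0 := Stage 2
  (fun i => match i with 0 => [set p] | 1 => U | _ => [set q] end)
  (fun i => match i with 0 => -1 | 1 => 0 | 2 => 1 | _ => 2 end).

Lemma valid_stage0 : valid stage0.
Proof.
split; split=> //=.
- by case=> [|[|i]].
- by case=> [|[|i]] // _; [exists p|exists q].
- move=> i j ij; have [-> ->] : i = 0%N /\ j = 2%N by lia.
  by rewrite /= !closure1; apply/seteqP; split=> // x [/= -> /pq].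
- case=> [|[|[|i]]] //= _; lra.
Qed.

Lemma finer_ex n s : valid s -> exists s', valid s' /\ finer n s s'.
Proof.
move=> [cs ts]; have e0 : 0 < 2^-1 ^+ n :> R by rewrite exprn_gt0 ?invr_gt0.
have [M' [c' [r [cM' [[r0 rM] step inner cc two]]]]] :=
  chain_refine cX locX cs e0.
have [M'1 _ _ _ _] := cM'.
have [|T' [tT' T'T T'half]] := timetable_refine ts M'1 r0 rM step _ two.
  by move=> j /inner[].
exists (Stage M' c' T'); split=> //; exists r; split=> j jM /=.
  have [? ?] := T'T j jM; split=> //; last exact: cc.
  have rmono k : (k <= M' - j)%N -> (r j <= r (j + k))%N.
    elim: k => [|k IH] kj; first by rewrite addn0.
    by rewrite addnS; apply: leq_trans (IH _) _; [lia|have := step (j + k)%N; lia].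
  by rewrite -rM; have := rmono (M' - j)%N; rewrite subnKC//; apply.
by have [? ?] := inner j jM; split=> //; exact: T'half.
Qed.

Lemma stages_ex : exists S : nat -> stage, S 0%N = stage0 /\
  forall n, valid (S n) /\ finer n (S n) (S n.+1).
Proof.
apply: indexed_dependent_choice; first exact: valid_stage0.
by move=> n s; exact: finer_ex.
Qed.

(** * The limit path of a sequence of finer chains *)

Section limit.
Variable S : nat -> stage.
Hypothesis S0 : S 0%N = stage0.
Hypothesis S_valid : forall n, valid (S n).
Hypothesis S_finer : forall n, finer n (S n) (S n.+1).

Definition cellS n := cell (M := last_link (S n)) (T := time (S n)).

Lemma link_neq0 n i : (i <= last_link (S n))%N -> S n i !=set0.
Proof.
have [[_ [_ cM] _ lc _] _] := S_valid n.
rewrite leq_eqVlt => /predU1P[->|/lc[x []]]; last by exists x.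
by rewrite cM; exists q.
Qed.

(** The interior link of [stage0] lasts one unit, and each stage at least halves durations. *)
Lemma timeS_gap n i : (0 < i < last_link (S n))%N ->
  time (S n) i.+1 - time (S n) i <= 2^-1 ^+ n.
Proof.
elim: n i => [|n IH] i iM.
  by move: iM; rewrite S0 /=; case: i => [|[|i]] //= _; lra.
have [r [_ h]] := S_finer n; have [_ /IH rM] := h i iM.
by move/le_trans; apply; rewrite exprSr ler_wpM2r// invr_ge0.
Qed.

Lemma closure_linkS_small n i x y : (i <= last_link (S n.+1))%N ->
  closure (S n.+1 i) x -> closure (S n.+1 i) y -> mdist x y <= 2^-1 ^+ n.
Proof.
move=> iM cx cy; have [[_ [c0 cM] _ _ _] _] := S_valid n.+1.
have [i0|i0] := posnP i.
  move: cx cy; rewrite i0 c0 !closure1 => -> ->.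
  by rewrite mdistxx exprn_ge0 ?invr_ge0.
have [i1|i1] := eqVneq i (last_link (S n.+1)).
  move: cx cy; rewrite i1 cM !closure1 => -> ->.
  by rewrite mdistxx exprn_ge0 ?invr_ge0.
have [r [_ h]] := S_finer n; have [|sm _ _] := h i; first lia.
apply/ler_addgt0Pr => e e0.
have e20 : 0 < e / 2 by rewrite divr_gt0.
have [x' [cx' /= xx']] := cx _ (nbhs_mdist_lt x e20).
have [y' [cy' /= yy']] := cy _ (nbhs_mdist_lt y e20).
have := sm x' y' cx' cy'; have := metric_triangle x x' y.
have := metric_triangle x' y' y; rewrite (metric_sym y' y).
move: xx' yy'; lra.
Qed.

Lemma cellS_finer n t j : cellS n.+1 t j -> exists2 i, cellS n t i &
  closure (S n.+1 j) `<=` S n i.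
Proof.
move=> [jM /andP[jt tj]]; have [r [h _]] := S_finer n.
have [rM cl tr tr'] := h j jM; exists (r j) => //; split=> //.
by rewrite (le_trans tr jt) (lt_le_trans tj).
Qed.

(** The closures of the links occupied at time [t] decrease, so by compactness they share a point,
    taken as [f t]. *)
Lemma path_ex : exists f : R -> X, forall t, -1 <= t < 2 ->
  forall n i, cellS n t i -> closure (S n i) (f t).
Proof.
suff /choice[f fP] : forall t, exists x, -1 <= t < 2 ->
    forall n i, cellS n t i -> closure (S n i) x by exists f.
move=> t; have [t12|] := boolP (-1 <= t < 2); last by exists p.
have /choice[i iP] n : exists i, cellS n t i.
  by have [_ tS] := S_valid n; exact: cell_ex t12.
have [n|n|n|x Dx] := @nested_closed_nonempty _ (fun n => closure (S n (i n))) cX.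
- exact: closed_closure.
- have [x Sx] := link_neq0 (iP n).1.
  by exists x; exact: subset_closure.
- move=> x; have [j cj h] := cellS_finer (iP n.+1).
  rewrite (cell_unique (S_valid n).2 (iP n) cj) => /h; exact: subset_closure.
exists x => _ n j cj.
by rewrite (cell_unique (S_valid n).2 cj (iP n)).
Qed.

Variable f : R -> X.
Hypothesis fP : forall t, -1 <= t < 2 ->
  forall n i, cellS n t i -> closure (S n i) (f t).

Let cellS_ex n t : 0 <= t <= 1 -> exists i, cellS n t i /\ (0 < i)%N.
Proof.
move=> t01; have [|i ci] := cell_ex (S_valid n).2 (t := t); first by move: t01; lra.
exists i; split=> //; apply: (cell_gt0 (S_valid n).2 ci).
by case/andP: t01.
Qed.

(** Time 0 belongs to link 1, not to [[set p]]; but link 1 meets [[set p]] and becomes arbitrarily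
    small. Time 1, by contrast, falls in the last link. *)
Lemma path0 : f 0 = p.
Proof.
apply/esym/mdist_positivity/eqP; rewrite eq_le mdist_ge0 andbT leNgt.
apply/negP => d0.
have [n nd] := half_expr_lt d0.
have [[M1 [c0 _] _ lc _] [_ T1 _ _ inc]] := S_valid n.+1.
have c1 : cellS n.+1 0 1%N by split; [lia|rewrite T1 lexx -{1}T1 inc; lia].
have f0 : closure (S n.+1 1%N) (f 0) by apply: fP c1; lra.
have [x [xp x1]] : S n.+1 0%N `&` S n.+1 1%N !=set0 by apply: lc; lia.
move: nd; rewrite ltNge => /negP; apply.
move: xp; rewrite c0 => /= <-.
by apply: closure_linkS_small (subset_closure x1) f0; lia.
Qed.

Lemma path1 : f 1 = q.
Proof.
have [[M1 [_ cM] _ _ _] [_ _ TM TM1 _]] := S_valid 0.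
have c1 : cellS 0 1 (last_link (S 0%N)) by split=> //; rewrite TM TM1 lexx ltr1n.
by have := fP _ c1; rewrite cM closure1; apply; lra.
Qed.

Lemma path_sub t : 0 <= t <= 1 -> U (f t).
Proof.
(* Stage 1 is used because the closure of [U] may leave [U], while closures of stage 1 links lie in
   links of stage 0. *)
move=> t01; have [i [ci _]] := cellS_ex 1 t01.
have [j [jM _] cl] := cellS_finer ci.
have : S 0%N j (f t) by apply/cl/(fP _ ci); move: t01; lra.
by rewrite S0; case: j {jM cl} => [|[|j]] //= ->.
Qed.

(** A time [s] near [t] is in cell [i] or [i.-1], and the two links share a point [x]: at most two
    errors of size [2^-1 ^+ n] arise. The times before 0 and after 1 give room at the ends. *)
Lemma path_continuous t : 0 <= t <= 1 -> {for t, continuous f}.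
Proof.
move=> t01; apply/metricType_numDomainType.cvgrPdist_le => e e0.
have e20 : 0 < e / 2 by rewrite divr_gt0.
have [n ne] := half_expr_lt e20.
have [i [ci i0]] := cellS_ex n.+1 t01.
have [[_ _ _ lc _] TS] := S_valid n.+1; have [T0 _ _ TM1 inc] := TS.
have [iM /andP[it ti]] := ci.
have it' : time (S n.+1) i.-1 < t.
  by apply: lt_le_trans it; rewrite -[X in _ < time _ X](prednK i0) inc; lia.
have iM1 : (i.-1 <= last_link (S n.+1))%N by exact: leq_trans (leq_pred i) iM.
have sm1 : time (S n.+1) 0 <= time (S n.+1) i.-1.
  by apply: (timetable_le TS); rewrite leq0n leqW.
have s2 : time (S n.+1) i.+1 <= time (S n.+1) (last_link (S n.+1)).+1.
  by apply: (timetable_le TS); rewrite ltnS iM leqnn.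
have [x [xi' xi]] : S n.+1 i.-1 `&` S n.+1 i !=set0.
  by rewrite -[in S n.+1 i](prednK i0); apply: lc; rewrite prednK.
near=> s.
have is_ : time (S n.+1) i.-1 < s by near: s; exact: lt_nbhsr.
have si : s < time (S n.+1) i.+1 by near: s; exact: lt_nbhsl.
have ft : closure (S n.+1 i) (f t) by apply: fP ci; move: t01; lra.
have s12 : -1 <= s < 2 by move: sm1 s2; rewrite T0 TM1; move: is_ si; lra.
have xt : mdist (f t) x <= 2^-1 ^+ n.
  exact: closure_linkS_small ft (subset_closure xi).
have [sT|Ts] := ltP s (time (S n.+1) i).
  have cs : cellS n.+1 s i.-1.
    split; first exact: iM1.
    by rewrite (prednK i0) sT andbT; exact: ltW.
  have xs : mdist x (f s) <= 2^-1 ^+ n.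
    exact: closure_linkS_small iM1 (subset_closure xi') (fP s12 cs).
  by have := metric_triangle (f t) x (f s); move: xt xs ne; lra.
have cs : cellS n.+1 s i by split=> //; rewrite Ts.
have := closure_linkS_small iM ft (fP s12 cs).
by move: ne e0; lra.
Unshelve. all: by end_near. Qed.

(** Once interior durations are below half of [t - s], the two times lie in nonadjacent cells, whose
    links have disjoint closures. *)
Lemma path_inj s t : 0 <= s -> s < t -> t <= 1 -> f s <> f t.
Proof.
move=> s0 st t1; have ts2 : 0 < (t - s) / 2 by rewrite divr_gt0// subr_gt0.
have [n nst] := half_expr_lt ts2.
have [i [ci i0]] : exists i, cellS n s i /\ (0 < i)%N by apply: cellS_ex; lra.
have [j [cj j0]] : exists i, cellS n t i /\ (0 < i)%N by apply: cellS_ex; lra.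
have [[M1 _ _ _ disj] TS] := S_valid n; have [T0 _ TM TM1 inc] := TS.
have ij := cell_le TS ci cj (ltW st).
have [iM /andP[si si']] := ci; have [jM /andP[tj tj']] := cj.
have iM' : (i < last_link (S n))%N.
  rewrite ltn_neqAle iM andbT; apply/eqP => iM'; move: si; rewrite iM' TM; lra.
have gi := @timeS_gap n i; rewrite i0 iM' /= in gi; have {}gi := gi isT.
have ij' : (i.+1 < j)%N.
  rewrite ltnNge; apply/negP => ji.
  have [jS|jS] : j = i \/ j = i.+1 by clear -ij ji; lia.
    by move: tj'; rewrite jS; move: gi nst si; lra.
  (* The last link always lasts one unit, but [t <= 1] can only be its starting time. *)
  have [jM'|jM'] := eqVneq j (last_link (S n)).
    have : t = 1 by move: tj; rewrite jM' TM; move: t1; lra.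
    by move: gi nst si; rewrite -jS jM' TM; lra.
  have gj : time (S n) j.+1 - time (S n) j <= 2^-1 ^+ n.
    by apply: timeS_gap; rewrite j0 ltn_neqAle jM' jM.
  by move: tj' gj gi nst si; rewrite -jS; lra.
move=> fst; have : (closure (S n i) `&` closure (S n j)) (f s).
  split; first by apply: fP ci; lra.
  by rewrite fst; apply: fP cj; lra.
by rewrite disj// ij' jM.
Qed.

End limit.

Theorem connected_open_arc : exists A, is_arc R A p q /\ A `<=` U.
Proof.
have [S [S0 /all_and2[S_valid S_finer]]] := stages_ex.
have [f fP] := path_ex S_valid S_finer.
exists (f @` `[0, 1]); split; last first.
  move=> _ [t /= t01 <-]; rewrite in_itv /= in t01.
  exact: (path_sub S0 S_valid S_finer fP).
have finj s t : s \in `[0, 1] -> t \in `[0, 1] -> f s = f t -> s = t.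
  rewrite !in_itv /= => /andP[s0 s1] /andP[t0 t1] fst.
  have inj := path_inj S0 S_valid S_finer fP.
  by have [st|ts|//] := ltgtP s t; [case: (inj s t)|case: (inj t s)].
have fcont : {within `[0, 1], continuous f}.
  apply: continuous_in_subspaceT => t; rewrite inE /= in_itv /= => t01.
  exact: (path_continuous S_valid S_finer fP).
(* [g] inverts [f] on the arc; off the arc its value is arbitrary. *)
have /choice[g gP] x : exists t, (exists2 s, s \in `[0, 1] & f s = x) ->
    t \in `[0, 1] /\ f t = x.
  have [[s s01 sx]|] := pselect (exists2 s, s \in `[0, 1] & f s = x).
    by exists s.
  by exists 0.
have fg : {in `[0, 1], cancel f g}.
  move=> t t01; have [|? ?] := gP (f t); first by exists t.
  exact: finj.
exists f, g; split=> //.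
- split=> //; apply: compact_cancel_continuous => //.
  + exact: metric_hausdorff.
  + exact: segment_compact.
  + exact: itv_closed.
  + by move=> t; rewrite inE; exact: fg.
- exact: (path0 S_valid S_finer fP).
- exact: (path1 S_valid fP).
Qed.

End arcs.

(** * Disjoint connected sets in a dendrite *)

Lemma is_arc_connected (R : realType) (X : topologicalType) (A : set X) x y :
  is_arc R A x y -> [/\ connected A, A x & A y].
Proof.
move=> [f [g [[fc _] <- _ <- <-]]].
split; [|by exists 0 => //=; rewrite in_itv /= lexx ler01|
         by exists 1 => //=; rewrite in_itv /= lexx ler01].
by apply: connected_continuous_connected fc; exact: segment_connected.
Qed.

Lemma connected_disjoint_open (T : topologicalType) (A U V : set T) :
  connected A -> open U -> open V -> U `&` V = set0 -> A `<=` U `|` V ->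
  A `&` U !=set0 -> A `<=` U.
Proof.
move=> cA oU oV UV0 AUV AU; apply: connected_local_ind => // x /AUV[Ux|Vx].
  by exists U; split.
exists V; split=> // y z _ _ Vy _ Uy.
by have : (U `&` V) y by []; rewrite UV0.
Qed.

Section dendrite.
Context {R : realType} {X : metricType R}.
Hypothesis hX : is_dendrite X.

(** The arcs from [p] to [q] through [V] and through [V'] coincide. As [V] and [V'] are disjoint,
    this arc lies in [B] and [B'], which would disconnect it. *)
Lemma dendrite_no_cycle (B B' V V' : set X) :
  [/\ open B, open B', open V & open V'] ->
  [/\ connected B, connected B', connected V & connected V'] ->
  B `&` B' = set0 -> V `&` V' = set0 ->
  B `&` V !=set0 -> B' `&` V !=set0 -> B `&` V' !=set0 -> B' `&` V' !=set0 ->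
  False.
Proof.
have [cX _ locX uniq] := hX.
move=> [oB oB' oV oV'] [cB cB' cV cV'] BB' VV' BV B'V BV' B'V'.
have [[p [Bp _]] [q [B'q _]]] := (BV, B'V).
have pq : p <> q.
  by move=> pq; have : (B `&` B') q by [split=> //; rewrite -pq]; rewrite BB'.
have arcs W : open W -> connected W -> B `&` W !=set0 -> B' `&` W !=set0 ->
    exists A, is_arc R A p q /\ A `<=` B `|` W `|` B'.
  move=> oW cW BW [x [B'x Wx]].
  apply: connected_open_arc => //; [by do 2?apply: openU| |by left; left|by right].
  apply: connectedU => //; last exact: connectedU.
  by exists x; split=> //; right.
have [A [arcA AV]] := arcs V oV cV BV B'V.
have [A' [arcA' AV']] := arcs V' oV' cV' BV' B'V'.
have [A0 [_ A0uniq]] := uniq p q pq.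
have AA' : A = A' by rewrite -(A0uniq A)// -(A0uniq A').
have [cA Ap Aq] := is_arc_connected arcA.
have /(_ q Aq) Bq : A `<=` B.
  apply: (connected_disjoint_open cA oB oB' BB'); last by exists p.
  move=> x Ax; have [[|Vx]|] := AV x Ax; [by left| |by right].
  have : (B `|` V' `|` B') x by apply: AV'; rewrite -AA'.
  case=> [[|V'x]|]; [by left| |by right].
  by have : (V `&` V') x by []; rewrite VV'.
by have : (B `&` B') q by []; rewrite BB'.
Qed.

Lemma dendrite_small_cover d : 0 < d ->
  exists (I : finType) (B : I -> set X),
    (forall i, [/\ open (B i), connected (B i) & small d (B i)]) /\
    forall x, exists i, B i x.
Proof.
have [cX _ locX _] := hX; move=> d0.
have /choice[W WP] (x : X) : exists V : set X,
    [/\ open V, V x, connected V & small d V].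
  by have [V [*]] := small_connected_nbhs locX openT (I : setT x) d0; exists V.
(* Near covering along the filter of finite sets of centres, directed by inclusion, yields a finite
   subcover. *)
pose F := filter_from setT
  (fun D : {fset X} => [set E : {fset X} | (D `<=` E)%fset]).
have FF : Filter F.
  apply: filter_from_filter; first by exists fset0.
  by move=> D E _ _; exists (D `|` E)%fset => // K /=; rewrite fsubUset => /andP[].
have : \forall D \near F, [set: X] `<=` [set x | exists2 y, y \in D & W y x].
  move: cX => /compact_near_coveringP; apply=> // x _.
  have [oW Wx _ _] := WP x.
  exists (W x, [set D : {fset X} | x \in D]) => /=.
    split; first exact: open_nbhs_nbhs.
    by exists [fset x]%fset => // D; rewrite /= fsub1set.
  by move=> [y D] /= [Wxy xD]; exists x.
move=> [D _ /(_ D (fsubset_refl D)) Dcov].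
exists D, (fun y : D => W (val y)); split=> [y|x]; first by have [] := WP (val y).
by have [y yD Wyx] := Dcov x I; exists [` yD]%fset.
Qed.

Lemma connected_join_bound d : 0 < d ->
  exists N, forall (I : finType) (V : I -> set X),
  (forall i, open (V i) /\ connected (V i)) ->
  (forall i j, i != j -> V i `&` V j = set0) ->
  (forall i, exists x y, [/\ V i x, V i y & d <= mdist x y]) ->
  (#|I| <= N)%N.
Proof.
move=> d0; have d20 : 0 < d / 2 by rewrite divr_gt0.
have [J [B [BP Bcov]]] := dendrite_small_cover d20.
(* Each [V i] is assigned the cover elements around two of its distant points; their size [d / 2]
   makes them disjoint. Absence of cycles makes the assignment injective. *)
exists #|{: J * J}| => I V ocV disj far.
have /choice[f fP] i : exists ab : J * J, [/\ B ab.1 `&` V i !=set0,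
    B ab.2 `&` V i !=set0 & B ab.1 `&` B ab.2 = set0].
  have [x [y [Vx Vy dxy]]] := far i.
  have [[a Bax] [b By]] := (Bcov x, Bcov y).
  exists (a, b); split; [by exists x|by exists y|].
  apply/seteqP; split=> // z [/= Baz Bbz].
  have [[_ _ sa] [_ _ sb]] := (BP a, BP b).
  have := sa x z Bax Baz; have := sb z y Bbz By.
  by have := metric_triangle x z y; move: dxy; lra.
apply: (leq_card f) => i j fij; apply/eqP/negPn/negP => ij.
have [Bi B'i BB'] := fP i; have [Bj B'j _] := fP j.
rewrite -fij in Bj B'j.
have [[oi ci] [oj cj]] := (ocV i, ocV j).
have [[oa ca _] [ob cb _]] := (BP (f i).1, BP (f i).2).
exact: (dendrite_no_cycle _ _ BB' (disj i j ij) Bi B'i Bj B'j).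
Qed.

End dendrite.

(** * Oscillation of the elements of the Ellis semigroup *)

Section action.
Context {G : topologicalGroupType} {X : topologicalType} {act : G -> X -> X}.
Hypothesis hact : continuous_action act.

Lemma act_continuous g : continuous (act g).
Proof.
have [_ _ ca] := hact; move=> x.
apply: (@continuous_comp _ _ _ (fun y => (g, y)) (fun gx => act gx.1 gx.2)).
  by apply: cvg_pair; [exact: cvg_cst|exact: cvg_id].
exact: ca.
Qed.

Lemma act_invK g : cancel (act g) (act g^-1%g).
Proof. by have [a1 aM _] := hact; move=> x; rewrite -aM mulVg a1. Qed.

Lemma act_Kinv g : cancel (act g^-1%g) (act g).
Proof. by have [a1 aM _] := hact; move=> x; rewrite -aM mulgV a1. Qed.

Lemma act_open g (V : set X) : open V -> open (act g @` V).
Proof.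
suff -> : act g @` V = act g^-1%g @^-1` V.
  by move=> oV; apply: open_comp oV => x _; exact: act_continuous.
apply/seteqP; split=> [_ [x Vx <-]|x Vx]; first by rewrite /preimage /= act_invK.
by exists (act g^-1%g x) => //; rewrite act_Kinv.
Qed.

Lemma act_connected g (V : set X) : connected V -> connected (act g @` V).
Proof.
move=> cV; apply: connected_continuous_connected cV _.
by apply: continuous_subspaceT; exact: act_continuous.
Qed.

End action.

Section oscillation.
Context {R : realType} {X : metricType R}.

(** Finitely many coordinates with tolerance [e] define a pointwise neighbourhood of [f], which
    meets the range of [act]. *)
Lemma ellis_approx (G : topologicalGroupType) (act : G -> X -> X) (f : X -> X)
    (I : finType) (u : I -> X) (e : R) :
  ellis_semigroup act f -> 0 < e ->
  exists g, forall i, mdist (f (u i)) (act g (u i)) < e.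
Proof.
move=> hf e0.
have near_f : \forall h \near (f : {ptws X -> X}),
    forall i, mdist (f (u i)) ((h : X -> X) (u i)) < e.
  apply: (@filter_forall {ptws X -> X} I
    (fun i => [set h : {ptws X -> X} | mdist (f (u i)) (h (u i)) < e])
    (nbhs (f : {ptws X -> X}))
    (nbhs_filter (f : {ptws X -> X}))) => i.
  exact: (@proj_continuous X (fun=> X) (u i) f _ (nbhs_mdist_lt (f (u i)) e0)).
by have [_ [[g _ <-] gP]] := hf _ near_f; exists g.
Qed.

(** The bound drops to [e / 2] since the supremum in [diam] need not be attained. *)
Lemma osc_far_pair (f : X -> X) (x : X) (e : R) (V : set X) : 0 < e ->
  (e%:E <= osc f x [set: X])%E -> open V -> V x ->
  exists u v, [/\ V u, V v & e / 2 < mdist (f u) (f v)].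
Proof.
move=> e0 ex oV Vx.
have : ((e / 2)%:E < diam (f @` (V `&` [set: X])))%E.
  apply: (@lt_le_trans _ _ e%:E).
    by rewrite lte_fin ltr_pdivrMr// ltr_pMr// ltr1n.
  by apply: le_trans ex _; apply: ereal_inf_lbound; exists V.
move=> /ereal_sup_gt[_ [[_ _] /= [[u [Vu _] <-] [v [Vv _] <-]] <-]].
by rewrite lte_fin => uv; exists u, v.
Qed.

Lemma finite_separated (I : finType) (x : I -> X) : injective x ->
  exists2 d : R, 0 < d & forall i j, i != j -> d <= mdist (x i) (x j).
Proof.
move=> xinj.
have h : \forall d \near 0^'+, forall ij : I * I, ij.1 != ij.2 ->
    d <= mdist (x ij.1) (x ij.2).
  apply: filter_forall => -[i j] /=; have [->|ij] := eqVneq i j.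
    by near=> d.
  have xij : 0 < mdist (x i) (x j) by rewrite mdist_gt0 inj_eq.
  by near=> d => _; near: d; exact: nbhs_right_le.
near (0 : R)^'+ => d; exists d; first by near: d; exact: nbhs_right_gt.
move=> i j ij.
have : forall ij : I * I, ij.1 != ij.2 -> d <= mdist (x ij.1) (x ij.2).
  by near: d.
by move=> /(_ (i, j)); exact.
Unshelve. all: by end_near. Qed.

Lemma osc_derivative_finite (G : topologicalGroupType) (act : G -> X -> X)
    (f : X -> X) (e : R) :
  is_dendrite X -> continuous_action act -> ellis_semigroup act f -> 0 < e ->
  finite_set (osc_derivative e f [set: X]).
Proof.
move=> hX hact hf e0; apply: contrapT => infD.
have [_ _ locX _] := hX.
have e4 : 0 < e / 4 by rewrite divr_gt0.
have [N bound] := connected_join_bound hX e4.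
have [B BD cardB] := infinite_set_fset N.+1 infD.
have [d d0 sep] := finite_separated (@val_inj _ _ B).
have d20 : 0 < d / 2 by rewrite divr_gt0.
(* Points of [B] are at least [d] apart, so neighbourhoods of size [d / 2] are disjoint. *)
have /choice[V VP] (i : B) : exists V : set X,
    [/\ open V, V (val i), connected V & small (d / 2) V].
  have [V [*]] := small_connected_nbhs locX openT (I : setT (val i)) d20.
  by exists V.
have /choice[u uP] (i : B) : exists uv : X * X,
    [/\ V i uv.1, V i uv.2 & e / 2 < mdist (f uv.1) (f uv.2)].
  have [oV Vi _ _] := VP i; have [_ osc_i] := BD _ (valP i).
  have [a [b [*]]] := osc_far_pair e0 osc_i oV Vi.
  by exists (a, b).
(* The errors at both points leave [e / 2 - e / 8 - e / 8 = e / 4], the distance for which [N] was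
   chosen. *)
have e8 : 0 < e / 8 by rewrite divr_gt0.
have [g gP] := ellis_approx
  (fun ib : B * bool => if ib.2 then (u ib.1).1 else (u ib.1).2) hf e8.
suff : (#|{: B}| <= N)%N by rewrite -cardfE leqNgt cardB.
apply: (bound _ (fun i => act g @` V i)) => [i|i j ij|i].
- by have [oV _ cV _] := VP i; split; [exact: act_open|exact: act_connected].
- apply/seteqP; split=> // _ [[x Vx <-] [y Vy /(can_inj (act_invK hact g)) yx]].
  rewrite yx in Vy.
  have [[_ Vi _ si] [_ Vj _ sj]] := (VP i, VP j).
  have := si _ _ Vi Vx; have := sj _ _ Vy Vj; have := sep i j ij.
  by have := metric_triangle (val i) x (val j); lra.
have [Vu Vv uv] := uP i.
exists (act g (u i).1), (act g (u i).2).
split; [by exists (u i).1|by exists (u i).2|].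
have /= g1 := gP (i, true); have /= g2 := gP (i, false).
have := metric_triangle (f (u i).1) (act g (u i).1) (f (u i).2).
have := metric_triangle (act g (u i).1) (act g (u i).2) (f (u i).2).
by move: uv g1 g2; rewrite (metric_sym (f (u i).2)); lra.
Qed.

(** Points of a finite set are isolated: removing the others leaves an open neighbourhood with
    one-point trace, so the oscillation is at most 0. *)
Lemma osc_derivative_of_finite (f : X -> X) (e : R) (D : set X) : 0 < e ->
  finite_set D -> osc_derivative e f D = set0.
Proof.
move=> e0 fD; apply/seteqP; split=> // x [Dx].
have oV : open (~` (D `\ x)).
  have /hausdorff_accessible/accessible_finite_set_closed := @metric_hausdorff R X.
  by move=> clX; apply: closed_openC; apply: clX; exact: finite_setD.
apply/negP; rewrite -ltNge; apply: (@le_lt_trans _ _ 0%E); last by rewrite lte_fin.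
apply: (@le_trans _ _ (diam (f @` (~` (D `\ x) `&` D)))).
  by apply: ereal_inf_lbound; exists (~` (D `\ x)) => //; split=> // -[_]; apply.
apply: ge_ereal_sup => _ [[_ _] /= [[y [yx Dy] <-] [z [zx Dz] <-]] <-].
have -> : y = x by apply: contrapT => yx'; apply: yx.
have -> : z = x by apply: contrapT => zx'; apply: zx.
by rewrite mdistxx.
Qed.

End oscillation.

(** * Ordinal suprema and the bound on the rank *)

Lemma ord_sup_le (A : set ord) (o : ord) : ubound A o -> (ord_sup A <= o)%O.
Proof.
move=> Ao; rewrite /ord_sup /supremum; case: ifPn => [_|A0].
  by case: o {Ao} => // a; exact: ozero_le.
case: xgetP => [s _ [_ smin]|noS]; first exact: smin.
by have [s /noS] := ord_supremums_neq0 A.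
Qed.

Lemma beta_le2 (R : realType) (X : metricType R) (f : X -> X) :
  (forall e : R, 0 < e -> finite_set (osc_derivative e f [set: X])) ->
  (beta f <= ord2)%O.
Proof.
move=> fin; apply: ord_sup_le => _ [e /= e0 <-].
(* The first derivative is finite, hence the second is empty. *)
have it2 : osc_iter e f (osucc (osucc ozero)) = set0.
  rewrite /osc_iter !transfinite_iterS transfinite_iter0.
  exact: osc_derivative_of_finite (fin e e0).
(* The least such ordinal rules out the default value [ord_omega1] in [beta_eps]. *)
have [a a0 amin] := @omega1_min [set a | osc_iter e f a = set0] (ex_intro _ _ it2).
rewrite /beta_eps; case: xgetP => [_ -> [b [-> _ bmin]]|/(_ (ord_countable a))].
  exact: bmin.
by case; exists a.
Qed.

Theorem theorem4p6 (R : realType) (X : metricType R)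
    (G : topologicalGroupType) (act : G -> X -> X) (f : X -> X)
    (hX : is_dendrite X) (hact : continuous_action act)
    (hfaithful : faithful_action act) (hf : ellis_semigroup act f) :
  [/\ forall e : R, 0 < e -> finite_set (osc_derivative e f [set: X]),
      (beta f <= ord2)%O
    & (beta_system act <= ord2)%O].
Proof.
have fin p : ellis_semigroup act p ->
    forall e : R, 0 < e -> finite_set (osc_derivative e p [set: X]).
  by move=> hp e; exact: (osc_derivative_finite hX hact hp).
split; [exact: fin|exact/beta_le2/fin|].
by apply: ord_sup_le => _ [p hp <-]; exact/beta_le2/fin.
Qed.
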